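(* Let $p$ be a prime and let $m>n$ be positive integers. Let $B\in\mathbb{F}_p^{m\times n}$ have rows $\mathbf{b}_1,\dots,\mathbf{b}_m$, and let $f(\mathbf{x})=\sum_{i=1}^m f_i(\mathbf{b}_i\cdot\mathbf{x})$ be a max-LINSAT objective function, where $f_i:\mathbb{F}_p\to\{+1,-1\}$ for $i=1,\dots,m$. Suppose that $|f_i^{-1}(+1)|=r$ for all $i$, for some $r\in\{1,\dots,p-1\}$. Let $\ell\ge 0$ be an integer such that $2\ell+1<d^\perp$, where $d^\perp$ is the minimum (Hamming) distance of the linear code $C^\perp=\{\mathbf{d}\in\mathbb{F}_p^m : B^T\mathbf{d}=\mathbf{0}\}$. Let $\mathbf{w}=(w_0,\dots,w_\ell)^T\in\mathbb{C}^{\ell+1}$ with $\mathbf{w}^\dagger\mathbf{w}=1$, and let $|P(f)\rangle=\sum_{k=0}^{\ell}w_k|P^{(k)}\rangle$ be the corresponding DQI state. Let $\langle s^{(m,\ell)}\rangle$ be the expected number of satisfied constraints for the string $\mathbf{x}\in\mathbb{F}_p^n$ obtained upon measuring $|P(f)\rangle$ in the computational basis. Then $$\langle s^{(m,\ell)}\rangle=\frac{mr}{p}+\frac{\sqrt{r(p-r)}}{p}\,\mathbf{w}^\dagger A^{(m,\ell,d)}\mathbf{w},$$ where $A^{(m,\ell,d)}$ is the $(\ell+1)\times(\ell+1)$ symmetric tridiagonal matrix $$A^{(m,\ell,d)}=\begin{pmatrix}0&a_1&&&\\ a_1&d&a_2&&\\ &a_2&2d&\ddots&\\ &&\ddots&\ddots&a_\ell\\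 &&&a_\ell&\ell d\end{pmatrix},\qquad a_k=\sqrt{k(m-k+1)},\qquad d=\frac{p-2r}{\sqrt{r(p-r)}}.$$
   Context: Constraint $i$ is satisfied by $\mathbf{x}\in\mathbb{F}_p^n$ if $f_i(\mathbf{b}_i\cdot\mathbf{x})=+1$ and unsatisfied if it equals $-1$; the number of satisfied constraints at $\mathbf{x}$ is $s(\mathbf{x})=(f(\mathbf{x})+m)/2$. The vectors $|\mathbf{x}\rangle$, $\mathbf{x}\in\mathbb{F}_p^n$, form the orthonormal computational basis of $\mathbb{C}^{p^n}$. Measuring a unit vector $\sum_{\mathbf{x}}c_{\mathbf{x}}|\mathbf{x}\rangle$ yields $\mathbf{x}$ with probability $|c_{\mathbf{x}}|^2$. Shifted-rescaled constraints: $g_i(x)=(f_i(x)-\overline f)/\varphi$, where $\overline f=\frac1p\sum_{x\in\mathbb{F}_p}f_i(x)=\frac{2r}{p}-1$ and $\varphi=\sqrt{\sum_{y\in\mathbb{F}_p}|f_i(y)-\overline f|^2}=2\sqrt{r(1-r/p)}$ (both independent of $i$). The degree-$k$ elementary symmetric polynomial in $m$ variables is $P^{(k)}(t_1,\dots,t_m)=\sum_{\{i_1,\dots,i_k\}}\prod_{j=1}^k t_{i_j}$, the sum being over all $k$-element subsets of $\{1,\dots,m\}$ (and $P^{(0)}=1$). The associated state is $$|P^{(k)}\rangle=\frac{1}{\sqrt{p^{n-k}\binom{m}{k}}}\sum_{\mathbf{x}\in\mathbb{F}_p^n}P^{(k)}\big(g_1(\mathbf{b}_1\cdot\mathbf{x}),\dots,g_m(\mathbf{b}_m\cdot\mathbf{x})\big)|\mathbf{x}\rangle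 .$$ A DQI state is a normalized state $\sum_{\mathbf{x}\in\mathbb{F}_p^n}P(f(\mathbf{x}))|\mathbf{x}\rangle$ with $P$ a univariate polynomial of degree $\ell$. It can be written as $\sum_{k=0}^\ell w_k|P^{(k)}\rangle$, which defines the coefficients $w_k$. *)

(* Defs.v *)
(* The complex numbers are R[i], for R : realType. *)
From HB Require Import structures.
From mathcomp Require Import all_boot all_order all_algebra.
From mathcomp Require Import sesquilinear spectral.
From mathcomp Require Import reals.
From mathcomp Require Export complex.

Set Implicit Arguments.
Unset Strict Implicit.
Unset Printing Implicit Defensive.

Import Order.TTheory GRing.Theory Num.Theory.

Local Open Scope ring_scope.
Local Open Scope complex_scope.
Local Open Scope sesquilinear_scope.

Definition hamming_dist (K : eqType) (m : nat) (u v : 'cV[K]_m) : nat :=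
  #|[set i | u i 0 != v i 0]|.

(* A code with at most one word has no minimum distance; a code with at least
   two words has exactly one. *)
Definition is_min_distance (K : finType) (m : nat) (C : {set 'cV[K]_m})
    (d : nat) : Prop :=
  (exists u v, [/\ u \in C, v \in C, u != v & hamming_dist u v = d]) /\
  (forall u v, u \in C -> v \in C -> u != v -> (d <= hamming_dist u v)%N).

Definition dual_code (p m n : nat) (B : 'M['F_p]_(m, n)) : {set 'cV['F_p]_m} :=
  [set d | B^T *m d == 0].

Section MaxLINSAT.
Variables (R : realType) (p m n : nat).
Variables (B : 'M['F_p]_(m, n)) (f : 'I_m -> 'F_p -> R).

Definition constraint_arg (i : 'I_m) (x : 'cV['F_p]_n) : 'F_p :=
  (row i B *m x) 0 0.

Definition objective (x : 'cV['F_p]_n) : R :=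
  \sum_(i < m) f i (constraint_arg i x).

Definition num_sat (x : 'cV['F_p]_n) : nat :=
  #|[set i | f i (constraint_arg i x) == 1]|.

Lemma num_satE (x : 'cV['F_p]_n) :
  (forall i y, f i y = 1 \/ f i y = -1) ->
  (num_sat x)%:R = (objective x + m%:R) / 2.
Proof.
move=> f_pm1; rewrite /num_sat /objective -sum1_card natr_sum.
have -> : m%:R = \sum_(i < m) (1 : R) by rewrite sumr_const card_ord.
rewrite -big_split mulr_suml big_mkcond; apply: eq_bigr => i _.
rewrite inE; case: (f_pm1 i (constraint_arg i x)) => -> /=.
  by rewrite eqxx -mulr2n divff // pnatr_eq0.
by rewrite addNr mul0r eq_sym -subr_eq0 opprK -mulr2n pnatr_eq0.
Qed.

Definition f_mean (i : 'I_m) : R := p%:R^-1 * \sum_(y : 'F_p) f i y.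

Definition f_norm (i : 'I_m) : R :=
  Num.sqrt (\sum_(y : 'F_p) `|f i y - f_mean i| ^+ 2).

Definition g (i : 'I_m) (y : 'F_p) : R := (f i y - f_mean i) / f_norm i.

End MaxLINSAT.

Definition esym (R : pzRingType) (m k : nat) (t : 'I_m -> R) : R :=
  \sum_(S : {set 'I_m} | #|S| == k) \prod_(i in S) t i.

(* A vector of C^(p^n), given by its amplitudes in the computational basis. *)
Definition state (R : realType) (p n : nat) := {ffun 'cV['F_p]_n -> R[i]^o}.

Section States.
Variables (R : realType) (p m n : nat).
Variables (B : 'M['F_p]_(m, n)) (f : 'I_m -> 'F_p -> R).

(* The exponent n - k is an integer, so it is not truncated at 0. *)
Definition esym_state (k : nat) : state R p n :=
  [ffun x => ((Num.sqrt (p%:R ^ (n%:Z - k%:Z) * 'C(m, k)%:R))^-1 *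
               esym k (fun i => g f i (constraint_arg B i x)))%:C].

(* Each g f i takes only two values, with mean and norm independent of i when all
   f i take the value 1 equally often; then esym k of the g's is a polynomial in
   the objective, so this is a superposition sum_x P(f(x)) |x>. *)
Definition dqi_state (l : nat) (w : 'cV[R[i]]_l.+1) : state R p n :=
  \sum_(k < l.+1) w k 0 *: esym_state k.

End States.

Section Measurement.
Variables (R : realType) (p n : nat).

Definition outcome_prob (psi : state R p n) (x : 'cV['F_p]_n) : R :=
  Normc.normc (psi x) ^+ 2.

(* Expectation of X over the outcome of measuring the unit vector psi. *)
Definition expected_value (psi : state R p n) (X : 'cV['F_p]_n -> R) : R :=
  \sum_x outcome_prob psi x * X x.

End Measurement.

Definition dqi_offdiag (R : realType) (m k : nat) : R :=
  Num.sqrt (k%:R * (m%:R - k%:R + 1)).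

Definition dqi_matrix (R : realType) (m l : nat) (d : R) : 'M[R]_l.+1 :=
  \matrix_(i < l.+1, j < l.+1)
    if i == j then i%:R * d
    else if j == i.+1 :> nat then dqi_offdiag R m j
    else if i == j.+1 :> nat then dqi_offdiag R m i
    else 0.

(* Main.v *)
(* Put h_i = sqrt p g_i. Then h_i has mean 0 and, being two-valued with mean
   square 1, satisfies h_i^2 = d h_i + 1. Fewer than dperp rows of B are linearly
   independent, so for uniform x the values b_i.x at fewer than dperp indices i
   are independent and uniform; hence the products h_S of the h_i over i in S are
   orthonormal as long as the sets involved are small enough. Up to an affine map
   the number of satisfied constraints is sum_i h_i, and multiplying the k-th
   elementary symmetric polynomial by sum_i h_i yields a combination of those of
   degree k + 1, k and k - 1: the rows of the tridiagonal matrix. The largest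
   index sets that occur have l + (l + 1) elements. *)
Require Import Defs.
From HB Require Import structures.
From mathcomp Require Import all_boot all_order all_algebra.
From mathcomp Require Import sesquilinear spectral reals complex.
From mathcomp Require Import ring zify.

Set Implicit Arguments.
Unset Strict Implicit.
Unset Printing Implicit Defensive.

Import Order.TTheory GRing.Theory Num.Theory.

Local Open Scope ring_scope.
Local Open Scope complex_scope.
Local Open Scope sesquilinear_scope.

(** * Independence of the values [b_i.x] at few indices *)

(** If row [i] were a combination of the rows in [U], the relation would be a nonzero word of the
    dual code of weight at most [#|U|.+1]. Otherwise the cokernel of the rows in [U] has a column
    that row [i] does not kill, and it can be rescaled. *)
Lemma separating_vector (p m n dperp : nat) (B : 'M['F_p]_(m, n))
    (U : {set 'I_m}) (i : 'I_m) :
  is_min_distance (dual_code B) dperp ->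
  i \notin U -> (#|U|.+1 < dperp)%N ->
  exists v : 'cV['F_p]_n, constraint_arg B i v = 1 /\
    forall j, j \in U -> constraint_arg B j v = 0.
Proof.
move=> [_ minB] iNU cardU.
pose D : 'M['F_p]_m := diag_mx (\row_j (j \in U)%:R).
have rowD j : j \in U -> row j (D *m B) = row j B.
  by move=> jU; rewrite row_mul row_diag_mx mxE jU scale1r -rowE.
case: (boolP (row i B <= D *m B)%MS) => [/submxP[u uE]|].
  (* The relation as a word: it is [1] at [i] and supported in [i |: U]. *)
  pose c : 'cV['F_p]_m := (delta_mx 0 i - u *m D)^T.
  have cE j : c j 0 = (i == j)%:R - u 0 j * (j \in U)%:R.
    rewrite !mxE [j == i]eq_sym /= (bigD1 j) //= big1 ?addr0.
      by rewrite !mxE eqxx.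
    by move=> k kj; rewrite !mxE (negbTE kj) mulr0.
  have c_dual : c \in dual_code B.
    rewrite inE -trmx_mul mulmxBl -rowE uE mulmxA subrr trmx0 eqxx //.
  have z_dual : 0 \in dual_code B by rewrite inE mulmx0.
  have c_neq0 : c != 0.
    apply/eqP => /matrixP/(_ i 0); rewrite cE mxE eqxx (negbTE iNU).
    by rewrite mulr0 subr0; apply/eqP; rewrite oner_eq0.
  have := minB _ _ c_dual z_dual c_neq0; rewrite leqNgt => /negP[].
  apply: leq_ltn_trans cardU.
  have -> : #|U|.+1 = #|i |: U| by rewrite cardsU1 iNU.
  apply: subset_leq_card; apply/subsetP => j; rewrite !inE cE mxE [i == j]eq_sym.
  by case: (j =P i) => //= _; case: (j \in U); rewrite ?mulr0 ?subr0 ?eqxx.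
rewrite submxE => /eqP nz.
have [k nzk] : exists k, (row i B *m cokermx (D *m B)) 0 k != 0.
  apply/existsP; apply: contra_notT nz; rewrite negb_exists => /forallP z.
  by apply/rowP => k; rewrite [RHS]mxE; apply/eqP; have := z k; rewrite negbK.
set a := (row i B *m _) 0 k in nzk.
pose v0 := col k (cokermx (D *m B)).
exists (a^-1 *: v0); split.
  rewrite /constraint_arg -scalemxAr mxE /v0 colE mulmxA -colE mxE -/a.
  exact: mulVf.
move=> j jU; rewrite /constraint_arg -scalemxAr mxE -(rowD j jU) /v0 colE.
by rewrite mulmxA -row_mul mulmx_coker row0 mul0mx mxE mulr0.
Qed.

Lemma constraint_argD (p m n : nat) (B : 'M['F_p]_(m, n)) i x y :
  constraint_arg B i (x + y) = constraint_arg B i x + constraint_arg B i y.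
Proof. by rewrite /constraint_arg mulmxDr mxE. Qed.

Lemma constraint_argZ (p m n : nat) (B : 'M['F_p]_(m, n)) i a x :
  constraint_arg B i (a *: x) = a * constraint_arg B i x.
Proof. by rewrite /constraint_arg -scalemxAr mxE. Qed.

(** Induction on [#|U|]: translating [x] along a vector that moves [b_i.x] but no other value
    indexed by [U] averages the [i]-th factor over the whole field. *)
Lemma sum_prod_constraint (R : numFieldType) (p m n dperp : nat)
    (B : 'M['F_p]_(m, n)) (q : 'I_m -> 'F_p -> R) (U : {set 'I_m}) :
  is_min_distance (dual_code B) dperp -> (#|U| < dperp)%N ->
  \sum_x \prod_(i in U) q i (constraint_arg B i x) =
    #|'cV['F_p]_n|%:R * \prod_(i in U) (#|'F_p|%:R^-1 * \sum_y q i y).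
Proof.
move=> minB; move: {2}#|U| (erefl #|U|) => k; elim: k U => [|k IHk] U.
  move/cards0_eq => -> _; rewrite big_set0 mulr1.
  by rewrite (eq_bigr (fun=> 1)) ?sumr_const // => x _; rewrite big_set0.
move=> cardU ltU; have [i iU] : exists i, i \in U.
  by apply/set0Pn; rewrite -card_gt0 cardU.
have cardUi : #|U :\ i| = k by have := cardsD1 i U; rewrite iU cardU => -[].
have iNUi : i \notin U :\ i by rewrite !inE eqxx.
have [|v [vi vj]] := separating_vector minB iNUi; first by rewrite cardUi -cardU.
have F_neq0 : #|'F_p|%:R != 0 :> R.
  by rewrite pnatr_eq0 -lt0n; apply/card_gt0P; exists 0.
rewrite [in RHS](big_setD1 i) //= mulrCA -IHk //; last first.
  by rewrite cardUi (leq_trans _ ltU) // ltnS cardU.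
rewrite -mulrA; apply: (canRL (mulKf F_neq0)).
(* The factor [#|'F_p|] pays for one copy of the sum per field element [t]. *)
rewrite mulr_natl -sumr_const mulr_sumr.
(* translate x by t v in the t-th copy of the sum *)
transitivity (\sum_(t : 'F_p) \sum_x
    \prod_(j in U) q j (constraint_arg B j (x + t *: v))).
  by apply: eq_bigr => t _; apply: (reindex_inj (addIr _)).
rewrite exchange_big; apply: eq_bigr => x _ /=.
rewrite mulr_suml [RHS](reindex_inj (addrI (constraint_arg B i x))) /=.
apply: eq_bigr => t _; rewrite (big_setD1 i) //=.
rewrite constraint_argD constraint_argZ vi mulr1; congr (_ * _).
apply: eq_bigr => j jU.
by rewrite constraint_argD constraint_argZ vj // mulr0 addr0.
Qed.

(** * Elementary symmetric polynomials *)

Section SymmetricFunctions.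
Variables (R : comRingType) (m : nat).
Implicit Types (S : {set 'I_m}) (t : 'I_m -> R).

(** Both sides run over the pairs of a [k]-set and an element outside it. *)
Lemma sum_set_add1 k (F : 'I_m -> {set 'I_m} -> R) :
  \sum_(S : {set 'I_m} | #|S| == k.+1) \sum_(i in S) F i (S :\ i) =
  \sum_(S : {set 'I_m} | #|S| == k) \sum_(i in ~: S) F i S.
Proof.
rewrite (exchange_big_dep xpredT) //= [RHS](exchange_big_dep xpredT) //=.
apply: eq_bigr => i _; symmetry.
rewrite [RHS](reindex_onto (fun S => i |: S) (fun S => S :\ i)) /=; last first.
  by move=> S /andP[_ iS]; rewrite setD1K.
apply: eq_big => [S|S /andP[_]]; last by rewrite inE => iS; rewrite setU1K.
rewrite inE setU11 andbT; case: (boolP (i \in S)) => iS /=.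
  rewrite andbF; apply/esym/negbTE; rewrite negb_and; apply/orP; right.
  by apply: contraTneq iS => <-; rewrite !inE eqxx.
by rewrite setU1K // eqxx cardsU1 iS !andbT.
Qed.

(* Multiplying a product over S by t_i adds i to S, or removes i from S up to
   a multiple of the same product. *)
Lemma mul_sum_esym d t k :
  (forall i, t i ^+ 2 = d * t i + 1) ->
  (\sum_i t i) * Defs.esym k t =
    k.+1%:R * Defs.esym k.+1 t + k%:R * d * Defs.esym k t +
    (if k is k'.+1 then (m - k')%:R * Defs.esym k' t else 0).
Proof.
move=> t2; rewrite {1}/Defs.esym mulr_sumr.
transitivity (\sum_(S : {set 'I_m} | #|S| == k)
   (\sum_(i in ~: S) \prod_(j in i |: S) t j +
    k%:R * d * \prod_(i in S) t i + \sum_(i in S) \prod_(j in S :\ i) t j)).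
  apply: eq_bigr => S /eqP cardS.
  rewrite mulr_suml (bigID (mem S)) /= addrC -addrA; congr (_ + _).
    by apply: eq_big => [i|i iS]; [rewrite inE | rewrite big_setU1].
  rewrite -cardS -mulrA mulr_natl -sumr_const -big_split /=.
  apply: eq_bigr => i iS; rewrite (big_setD1 i) //= mulrA -expr2 t2.
  by rewrite mulrDl mul1r mulrA.
rewrite !big_split /= -mulr_sumr; congr (_ + _ + _).
  (* Each [k.+1]-set arises once for each of its elements. *)
  rewrite -(sum_set_add1 k (fun i S => \prod_(j in i |: S) t j)) mulr_sumr.
  apply: eq_bigr => S /eqP cardS; rewrite -cardS mulr_natl -sumr_const.
  by apply: eq_bigr => i iS; rewrite setD1K.
case: k => [|k].
  by rewrite big1 // => S; rewrite cards_eq0 => /eqP ->; rewrite big_set0.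
(* Each [k]-set arises once for each of the [m - k] elements outside it. *)
rewrite (sum_set_add1 k (fun i S => \prod_(j in S) t j)) mulr_sumr.
apply: eq_bigr => S /eqP cardS.
by rewrite sumr_const mulr_natl cardsCs setCK card_ord cardS.
Qed.

Lemma esymZ a t k : Defs.esym k (fun i => a * t i) = a ^+ k * Defs.esym k t.
Proof.
rewrite /Defs.esym mulr_sumr; apply: eq_bigr => S /eqP cardS.
by rewrite big_split /= prodr_const cardS.
Qed.

End SymmetricFunctions.

(** * Orthogonality relations *)

Section Orthogonality.
Variables (R : numFieldType) (p m n dperp : nat) (B : 'M['F_p]_(m, n)).
Variables (h : 'I_m -> 'F_p -> R) (d : R).
Hypothesis minB : is_min_distance (dual_code B) dperp.
Hypothesis sum_h : forall i, \sum_y h i y = 0.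
Hypothesis sqr_h : forall i y, h i y ^+ 2 = d * h i y + 1.

Let t x i := h i (constraint_arg B i x).

(** The mean over [x] factors over [S :|: T]. An index in both sets contributes the mean of [h_i^2],
    which is 1; an index in only one contributes the mean of [h_i], which is 0. *)
Lemma sum_prodM (S T : {set 'I_m}) : (#|S :|: T| < dperp)%N ->
  \sum_x (\prod_(i in S) t x i) * (\prod_(i in T) t x i) =
    #|'cV['F_p]_n|%:R * (S == T)%:R.
Proof.
move=> ltST.
pose q i y := (if i \in S then h i y else 1) * (if i \in T then h i y else 1).
transitivity (\sum_x \prod_(i in S :|: T) q i (constraint_arg B i x)).
  apply: eq_bigr => x _.
  rewrite [in LHS]big_mkcond [X in _ * X]big_mkcond -big_split [RHS]big_mkcond.
  apply: eq_bigr => i _; rewrite inE /q /t.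
  by case: (i \in S); case: (i \in T); rewrite //= mulr1.
rewrite (sum_prod_constraint _ minB ltST); congr (_ * _).
have F_neq0 : #|'F_p|%:R != 0 :> R.
  by rewrite pnatr_eq0 -lt0n; apply/card_gt0P; exists 0.
case: eqP => [eST|/eqP neST].
  rewrite -eST setUid big1 // => i iS.
  under eq_bigr do rewrite /q -eST iS -expr2 sqr_h.
  by rewrite big_split /= -mulr_sumr sum_h mulr0 add0r sumr_const mulVf.
have [i iST] : exists i, (i \in S) != (i \in T).
  apply/existsP; apply: contraR neST; rewrite negb_exists => /forallP eST.
  by apply/eqP/setP => i; have := eST i; rewrite negbK => /eqP.
rewrite (bigD1 i) /=; last first.
  by move: iST; rewrite inE; case: (i \in S); case: (i \in T).
suff -> : \sum_y q i y = 0 by rewrite mulr0 mul0r.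
rewrite -[RHS](sum_h i); apply: eq_bigr => y _; rewrite /q.
by move: iST; case: (i \in S); case: (i \in T) => // _; rewrite ?mulr1 ?mul1r.
Qed.

(** Only pairs [S = T] survive, and the unions involved have at most [j + k] elements. *)
Lemma sum_esymM j k : (j + k < dperp)%N ->
  \sum_x Defs.esym j (t x) * Defs.esym k (t x) =
    #|'cV['F_p]_n|%:R * ((j == k)%:R * 'C(m, k)%:R).
Proof.
move=> ltjk; rewrite /Defs.esym.
under eq_bigr do rewrite big_distrlr /=.
rewrite exchange_big /=.
transitivity (\sum_(S : {set 'I_m} | #|S| == j)
    \sum_(T : {set 'I_m} | #|T| == k) #|'cV['F_p]_n|%:R * (S == T)%:R : R).
  apply: eq_bigr => S /eqP cardS; rewrite exchange_big /=.
  apply: eq_bigr => T /eqP cardT; apply: sum_prodM.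
  by rewrite (leq_ltn_trans (leq_card_setU _ _)) // cardS cardT.
under eq_bigr do rewrite -mulr_sumr.
rewrite -mulr_sumr exchange_big /=; congr (_ * _).
transitivity (\sum_(T : {set 'I_m} | #|T| == k) (j == k)%:R : R).
  apply: eq_bigr => T /eqP cardT; case: eqP => [->|nejk].
    rewrite (bigD1 T) ?cardT //= eqxx big1 ?addr0 // => S /andP[_ /negbTE ST].
    by rewrite ST.
  rewrite big1 // => S /eqP cardS; case: eqP => // eST.
  by case: nejk; rewrite -cardS -cardT eST.
rewrite sumr_const -[LHS]mulr_natr -[m in RHS]card_ord -card_draws.
by congr (_ * _%:R); apply: eq_card => S; rewrite !inE.
Qed.

(** [mul_sum_esym] reduces this to [sum_esymM] in degrees [k + 1], [k] and [k - 1]; the top degree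
    dictates the bound. *)
Lemma sum_esymM_linear j k : (j + k.+1 < dperp)%N ->
  \sum_x Defs.esym j (t x) * Defs.esym k (t x) * \sum_i t x i =
    #|'cV['F_p]_n|%:R *
      ((j == k.+1)%:R * (k.+1%:R * 'C(m, k.+1)%:R) +
       (j == k)%:R * (k%:R * d * 'C(m, k)%:R) +
       (k == j.+1)%:R * (k%:R * 'C(m, k)%:R)).
Proof.
move=> ltjk.
have ltjk' : (j + k < dperp)%N by apply: leq_trans ltjk; rewrite ltnS leq_add2l.
under eq_bigr => x _.
  rewrite -mulrA [X in _ * X]mulrC (@mul_sum_esym _ _ d); last first.
    by move=> i; apply: sqr_h.
  rewrite !mulrDr mulrCA [X in _ + X + _]mulrCA.
  over.
rewrite !big_split /= -!mulr_sumr !sum_esymM // !mulrDr.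
congr (_ + _ + _); try by ring.
case: k ltjk ltjk' => [|k] ltjk ltjk'.
  by rewrite mul0r !mulr0 big1 // => x _; rewrite mulr0.
under eq_bigr do rewrite mulrCA.
rewrite -mulr_sumr sum_esymM; last first.
  by apply: leq_trans ltjk'; rewrite ltnS leq_add2l.
(* The lowered degree carries [(m - k) 'C(m, k)], which equals [k.+1 'C(m, k.+1)]. *)
rewrite -[k.+1%:R * _]natrM mul_bin_left natrM eqSS [k == j]eq_sym; ring.
Qed.

End Orthogonality.

(** As [k.+1 'C(m, k.+1) = (m - k) 'C(m, k)], the product under the roots is a perfect square.
    Dividing by the norms of the two polynomials leaves the off-diagonal entry. *)
Lemma mul_bin_offdiag (R : realType) (m k : nat) : (k < m)%N ->
  k.+1%:R * 'C(m, k.+1)%:R =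
    dqi_offdiag R m k.+1 * (Num.sqrt 'C(m, k.+1)%:R * Num.sqrt 'C(m, k)%:R).
Proof.
move=> ltkm; rewrite /dqi_offdiag.
have -> : m%:R - k.+1%:R + 1 = (m - k)%:R :> R.
  by rewrite natrB ?(ltnW ltkm) // -natr1; ring.
rewrite -!natrM -!sqrtrM ?ler0n // -!natrM.
have -> : (k.+1 * (m - k) * ('C(m, k.+1) * 'C(m, k)) =
    (k.+1 * 'C(m, k.+1)) ^ 2)%N.
  by rewrite -mulnn {2}mul_bin_left mulnACA.
by rewrite natrX sqrtr_sqr ger0_norm // ler0n.
Qed.

(** * The rescaled constraints [h_i = sqrt p g_i] *)

Section Constraints.
Variables (R : realType) (p m r : nat) (f : 'I_m -> 'F_p -> R).
Hypothesis p_prime : prime p.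
Hypothesis f_pm1 : forall i y, f i y = 1 \/ f i y = -1.
Hypothesis r_gt0 : (0 < r)%N.
Hypothesis ltrp : (r < p)%N.
Hypothesis card_f1 : forall i, #|[set y | f i y == 1]| = r.

Let s : R := Num.sqrt (r%:R * (p%:R - r%:R)).

Let p_gt0 : 0 < p%:R :> R. Proof. by rewrite ltr0n prime_gt0. Qed.

Let rpr_gt0 : 0 < r%:R * (p%:R - r%:R) :> R.
Proof. by rewrite mulr_gt0 ?ltr0n // subr_gt0 ltr_nat. Qed.

Let s_gt0 : 0 < s. Proof. by rewrite sqrtr_gt0. Qed.

Let sqr_s : s ^+ 2 = r%:R * (p%:R - r%:R).
Proof. by rewrite sqr_sqrtr // ltW. Qed.

Lemma sum_pm1 i : \sum_y f i y = 2 * r%:R - p%:R.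
Proof.
transitivity (\sum_(y : 'F_p) (2 * (f i y == 1)%:R - 1 : R)).
  apply: eq_bigr => y _; case: (f_pm1 i y) => ->.
    by rewrite eqxx /=; ring.
  have /negbTE -> : -1 != 1 :> R by rewrite lt_eqF // gtrN.
  by rewrite /=; ring.
rewrite big_split /= -mulr_sumr sumr_const card_Fp // mulNrn.
congr (_ * _ - _); rewrite -[in RHS](card_f1 i) -sum1_card natr_sum.
by rewrite [RHS]big_mkcond; apply: eq_bigr => y _; rewrite inE; case: eqP.
Qed.

Lemma f_meanE i : f_mean f i = 2 * r%:R / p%:R - 1.
Proof. by rewrite /f_mean sum_pm1; field; rewrite gt_eqF. Qed.

Lemma f_normE i : f_norm f i = 2 * s / Num.sqrt p%:R.
Proof.
have sp_gt0 : 0 < Num.sqrt p%:R :> R by rewrite sqrtr_gt0.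
rewrite /f_norm; set v := \sum_y _.
suff -> : v = (2 * s / Num.sqrt p%:R) ^+ 2.
  by rewrite sqrtr_sqr ger0_norm // divr_ge0 ?mulr_ge0 ?sqrtr_ge0.
rewrite !exprMn exprVn sqr_s sqr_sqrtr ?ler0n // {}/v.
(* Since [f_i^2 = 1], the squared deviation is affine in [f_i]. *)
transitivity (\sum_(y : 'F_p)
    ((1 + f_mean f i ^+ 2) - 2 * f_mean f i * f i y : R)).
  apply: eq_bigr => y _; rewrite real_normK ?num_real //.
  by case: (f_pm1 i y) => ->; ring.
rewrite big_split /= sumrN -mulr_sumr sum_pm1 sumr_const card_Fp //.
by rewrite -[X in X - _]mulr_natr f_meanE; field; rewrite gt_eqF.
Qed.

Lemma scaled_gE i y :
  Num.sqrt p%:R * g f i y = (p%:R * f i y - (2 * r%:R - p%:R)) / (2 * s).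
Proof.
have sp_gt0 : 0 < Num.sqrt p%:R :> R by rewrite sqrtr_gt0.
have := sqr_sqrtr (ler0n R p); rewrite /g f_normE f_meanE.
set q := Num.sqrt p%:R in sp_gt0 * => <-.
by field; rewrite !gt_eqF.
Qed.

Lemma sum_scaled_g i : \sum_y Num.sqrt p%:R * g f i y = 0.
Proof.
under eq_bigr do rewrite scaled_gE.
rewrite -mulr_suml big_split /= -mulr_sumr sum_pm1 sumr_const card_Fp //.
by rewrite -mulr_natr; ring.
Qed.

(** The two values [(p - r) / s] and [- r / s] have sum [(p - 2 r) / s] and product [-1]. *)
Lemma sqr_scaled_g i y :
  (Num.sqrt p%:R * g f i y) ^+ 2 =
  (p%:R - 2 * r%:R) / s * (Num.sqrt p%:R * g f i y) + 1.
Proof.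
rewrite scaled_gE; apply/(mulIf (x := s ^+ 2)); first by rewrite expf_neq0 ?gt_eqF.
rewrite [RHS]mulrDl mul1r {3}sqr_s.
by case: (f_pm1 i y) => ->; field; rewrite gt_eqF.
Qed.

(** Solving [scaled_gE] for [f_i] gives [(f_i + 1) / 2 = (r + s h_i) / p]. *)
Lemma num_sat_g n (B : 'M['F_p]_(m, n)) x :
  (num_sat B f x)%:R = m%:R * r%:R / p%:R +
    s / p%:R * \sum_i Num.sqrt p%:R * g f i (constraint_arg B i x).
Proof.
rewrite num_satE // /objective mulr_sumr.
have -> : m%:R * r%:R / p%:R = \sum_(i < m) (r%:R / p%:R : R).
  by rewrite sumr_const card_ord -[RHS]mulr_natl mulrA.
have -> : m%:R = \sum_(i < m) (1 : R) by rewrite sumr_const card_ord.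
rewrite -!big_split mulr_suml; apply: eq_bigr => i _ /=.
by rewrite scaled_gE; field; rewrite !gt_eqF.
Qed.

End Constraints.

(** * Measurement as a quadratic form in the coefficients *)

(** Expand [|z|^2 = z z^*]; the [u k x] are real, so conjugation affects only [w]. *)
Lemma expected_value_comb (R : realType) (p n l : nat) (w : 'cV[R[i]]_l)
    (u : 'I_l -> 'cV['F_p]_n -> R) (X : 'cV['F_p]_n -> R) :
  (expected_value (\sum_k w k 0 *: ([ffun x => (u k x)%:C] : state R p n)) X)%:C
    = (w^t* *m map_mx (real_complex R)
         (\matrix_(j, k) \sum_x u j x * u k x * X x) *m w) 0 0.
Proof.
rewrite mxE; under [RHS]eq_bigr do rewrite mxE mulr_suml.
rewrite exchange_big /=.
under [RHS]eq_bigr do under eq_bigr do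
  rewrite !mxE rmorph_sum mulr_sumr mulr_suml.
under [RHS]eq_bigr do rewrite exchange_big /=.
rewrite exchange_big /expected_value rmorph_sum; apply: eq_bigr => x _ /=.
rewrite rmorphM /outcome_prob rmorphXn /=.
set z := (X in Normc.normc X).
have -> : (Normc.normc z)%:C ^+ 2 = z * z^* by rewrite -normCK.
have -> : z = \sum_k w k 0 * (u k x)%:C.
  by rewrite /z sum_ffunE; apply: eq_bigr => k _; rewrite !ffunE.
rewrite [X in _ * X * _]rmorph_sum mulrC big_distrlr mulr_sumr /=.
rewrite exchange_big; apply: eq_bigr => j _; rewrite mulr_sumr.
apply: eq_bigr => k _; rewrite !rmorphM /=.
have -> : Num.conj (u k x)%:C = (u k x)%:C by apply: conjc_real.
by ring.
Qed.

(** [p^n] is the number of strings, and the remaining [p^k] under the root is absorbed by scaling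
    each of the [k] factors by [sqrt p]. *)
Lemma esym_stateE (R : realType) (p m n k : nat) (B : 'M['F_p]_(m, n))
    (f : 'I_m -> 'F_p -> R) x : prime p ->
  esym_state B f k x =
    ((Num.sqrt #|'cV['F_p]_n|%:R * Num.sqrt 'C(m, k)%:R)^-1 *
     Defs.esym k (fun i => Num.sqrt p%:R * g f i (constraint_arg B i x)))%:C.
Proof.
move=> p_prime; have p_gt0 : 0 < p%:R :> R by rewrite ltr0n prime_gt0.
have sp_gt0 : 0 < Num.sqrt p%:R :> R by rewrite sqrtr_gt0.
rewrite ffunE esymZ card_mx card_Fp // muln1 natrX.
have -> : (p%:R ^ (n%:Z - k%:Z))%R = p%:R ^+ n / p%:R ^+ k :> R.
  by rewrite expfzDr ?gt_eqF // exprnN.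
rewrite !sqrtrM ?mulr_ge0 ?invr_ge0 ?exprn_ge0 ?ler0n //.
rewrite sqrtrV ?exprn_ge0 ?ler0n //.
have sqX j : Num.sqrt (p%:R ^+ j) = Num.sqrt p%:R ^+ j :> R.
  by elim: j => [|j IHj]; rewrite ?expr0 ?sqrtr1 // !exprS sqrtrM ?ler0n // IHj.
rewrite !sqX !invfM invrK mulrA; congr (_ * _)%:C.
ring.
Qed.

Theorem theorem3 (R : realType) (p m n r l dperp : nat)
    (B : 'M['F_p]_(m, n)) (f : 'I_m -> 'F_p -> R) (w : 'cV[R[i]]_l.+1)
    (p_prime : prime p)
    (n_gt0 : (0 < n)%N) (ltnm : (n < m)%N)
    (f_pm1 : forall i y, f i y = 1 \/ f i y = -1)
    (r_gt0 : (0 < r)%N) (ltrp : (r < p)%N)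
    (card_f1 : forall i, #|[set y | f i y == 1]| = r)
    (dperpP : is_min_distance (dual_code B) dperp)
    (l_small : (2 * l + 1 < dperp)%N)
    (w_unit : w^t* *m w = 1%:M) :
  let d : R := (p%:R - 2 * r%:R) / Num.sqrt (r%:R * (p%:R - r%:R)) in
  (expected_value (dqi_state B f w) (fun x => (num_sat B f x)%:R))%:C =
    (m%:R * r%:R / p%:R)%:C +
    (Num.sqrt (r%:R * (p%:R - r%:R)) / p%:R)%:C *
      (w^t* *m map_mx (real_complex R) (dqi_matrix m l d) *m w) 0 0.
Proof.
move=> d.
have p_gt0 : 0 < p%:R :> R by rewrite ltr0n prime_gt0.
have N_gt0 : 0 < #|'cV['F_p]_n|%:R :> R.
  by rewrite ltr0n; apply/card_gt0P; exists 0.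
(* Words of length [m] differ in at most [m] places, so [dperp <= m]. Hence the binomials ['C(m, k)]
   with [k <= l] are nonzero and can be divided by. *)
have ltlm : (l < m)%N.
  have [[u [v [_ _ _ dE]]] _] := dperpP.
  have := l_small; rewrite -dE => ltl.
  have := leq_trans ltl (max_card _); rewrite card_ord; lia.
have -> : dqi_state B f w = \sum_(k < l.+1) w k 0 *: [ffun x =>
    ((Num.sqrt #|'cV['F_p]_n|%:R * Num.sqrt 'C(m, k)%:R)^-1 *
     Defs.esym k (fun i => Num.sqrt p%:R * g f i (constraint_arg B i x)))%:C].
  apply: eq_bigr => k _; congr (_ *: _); apply/ffunP => x.
  by rewrite esym_stateE // ffunE.
rewrite expected_value_comb.
set M := (X in map_mx (real_complex R) X).
have -> : M = (m%:R * r%:R / p%:R)%:M +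
    (Num.sqrt (r%:R * (p%:R - r%:R)) / p%:R) *: dqi_matrix m l d.
  apply/matrixP => j k; rewrite !mxE.
  have lej : (j <= l)%N by rewrite -ltnS.
  have lek : (k <= l)%N by rewrite -ltnS.
  have sC_gt0 (i : 'I_l.+1) : 0 < Num.sqrt 'C(m, i)%:R :> R.
    by rewrite sqrtr_gt0 ltr0n bin_gt0 (leq_trans _ ltlm) // ltnW // ltnS.
  have sN_gt0 : 0 < Num.sqrt #|'cV['F_p]_n|%:R :> R by rewrite sqrtr_gt0.
  have sum_h := @sum_scaled_g R p m r f p_prime f_pm1 r_gt0 ltrp card_f1.
  have sqr_h := @sqr_scaled_g R p m r f p_prime f_pm1 r_gt0 ltrp card_f1.
  pose c k := (Num.sqrt #|'cV['F_p]_n|%:R * Num.sqrt 'C(m, k)%:R)^-1 : R.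
  pose t x i := Num.sqrt p%:R * g f i (constraint_arg B i x).
  transitivity (c j * c k * (m%:R * r%:R / p%:R *
      \sum_x Defs.esym j (t x) * Defs.esym k (t x) +
      Num.sqrt (r%:R * (p%:R - r%:R)) / p%:R *
      \sum_x Defs.esym j (t x) * Defs.esym k (t x) * \sum_i t x i)).
    rewrite 2!mulr_sumr -big_split mulr_sumr; apply: eq_bigr => x _ /=.
    by rewrite (@num_sat_g _ _ _ r) // /c /t; ring.
  (* Here [j + k <= 2 l]; the next sum needs [j + k + 1 <= 2 l + 1], exactly what [l_small]
     grants. *)
  rewrite (sum_esymM dperpP sum_h sqr_h); last by lia.
  rewrite (sum_esymM_linear dperpP sum_h sqr_h); last by lia.
  rewrite -/d /c; move: (sqr_sqrtr (ltW N_gt0)).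
  set sN := Num.sqrt #|_|%:R in sN_gt0 * => <-.
  have nS i : (i == i.+1) = false by apply/negbTE; rewrite neq_ltn ltnSn.
  have ltkm (i : 'I_l.+1) : (i < m)%N by rewrite (leq_ltn_trans _ ltlm) // -ltnS.
  (* Diagonal, superdiagonal, subdiagonal and zero entries in turn; at most one of the three
     indicators is nonzero in each case. *)
  rewrite -val_eqE /=; case: eqP => [jk|_].
    rewrite jk !nS; move: (sC_gt0 k) (sqr_sqrtr (ler0n R 'C(m, k))).
    set sC := Num.sqrt 'C(m, k)%:R => sC0 <-.
    by rewrite /= mulr1n; field; rewrite !gt_eqF.
  case: (k =P j.+1 :> nat) => [kj|_].
    have := mul_bin_offdiag R (ltkm j); rewrite -kj => ->.
    have /negbTE -> : (j : nat) != k.+1 by rewrite kj; lia.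
    by rewrite /= mulr0n; field; rewrite !gt_eqF.
  case: eqP => [jk|_].
    rewrite (mul_bin_offdiag R (ltkm k)) -jk.
    by rewrite /= mulr0n; field; rewrite !gt_eqF.
  by rewrite /= mulr0n; ring.
(* Normalization of [w] turns the scalar matrix into the constant term. *)
rewrite map_mxD map_scalar_mx map_mxZ mulmxDr mulmxDl.
rewrite -scalemxAr -scalemxAl mul_mx_scalar -scalemxAl w_unit !mxE.
by rewrite mulr1.
Qed.
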